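(* Let $p>3$ be a prime and $e\ge 2$ an integer. Consider all IPRNGs $(a,b,x_0)$ with $a\in\mathbb{Z}_{p^e}^{\times}$, $b\in(p)$, $x_0\in\mathbb{Z}_{p^e}$. For a positive integer $N$, let $c(N)$ be the number of these IPRNGs of period $N$. Then the possible periods and their numbers are: (1) $c(1)=(p-1)\left(p^{3e-3}+p^{2e-2}\right)$; (2) $c(2)=(ep-e-1)(p-1)p^{2e-2}$; (3) for each $j$ with $1\le j\le e-1$, $$c(2p^{j})=(p-1)^2(p-2)p^{3e-k-3}\Big|_{k=e-j}+\sum_{\substack{1\le k\le e-1,\ 1\le s\le e-k-1\\ e-k-s=j}}(p-1)^3p^{3e-k-s-3};$$ (4) $c(N)=0$ for every other $N$.
   Context: $\mathbb{Z}_{p^e}=\mathbb{Z}/p^e\mathbb{Z}$, with group of units $\mathbb{Z}_{p^e}^{\times}$; $(p)=p\,\mathbb{Z}_{p^e}$ is the set of non-units. An inversive pseudorandom number generator (IPRNG) is a triple $(a,b,x_0)\in\mathbb{Z}_{p^e}^3$, with map $\phi:\mathbb{Z}_{p^e}\to\mathbb{Z}_{p^e}$, $\phi(x)=ax^{-1}+b$ if $x\in\mathbb{Z}_{p^e}^{\times}$ and $\phi(x)=b$ if $x\in(p)$, and sequence $x_{n+1}=\phi(x_n)$, $n\ge 0$, started at $x_0$. Its period $L(x_0;a,b)$ is the least positive integer $L$ such that, for some $n_0\ge 0$, $x_{n+L}=x_n$ for all $n\ge n_0$. The number of IPRNGs of a given period is the number of such triples. *)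

(* Defs.v *)
From mathcomp Require Import all_boot all_order all_algebra.
From mathcomp Require Import boolp.

Set Implicit Arguments.
Unset Strict Implicit.
Unset Printing Implicit Defensive.

Import GRing.Theory.

Local Open Scope ring_scope.

(* The case split is kept explicit: in MathComp x^-1 = x for a non-unit x, so
   a * x^-1 + b alone would not be the intended map on non-units. *)
Definition iprng_map (R : comUnitRingType) (a b x : R) : R :=
  if x \is a GRing.unit then a * x^-1 + b else b.

Definition iprng_seq (R : comUnitRingType) (a b x0 : R) (n : nat) : R :=
  iter n (iprng_map a b) x0.

Definition eventually_repeats (T : Type) (u : nat -> T) (L : nat) : Prop :=
  exists n0 : nat, forall n : nat, (n0 <= n)%N -> u (n + L)%N = u n.

Definition has_period (T : Type) (u : nat -> T) (L : nat) : Prop :=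
  [/\ (0 < L)%N,
      eventually_repeats u L &
      forall M : nat, (0 < M)%N -> eventually_repeats u M -> (L <= M)%N].

(* 'Z_(p ^ e) is Z / p^e Z as soon as 1 < p ^ e, e.g. for p prime and e > 0. *)
Definition multiples (p e : nat) : {set 'Z_(p ^ e)} :=
  [set p%:R * y | y : 'Z_(p ^ e)].

(* Triples are (a, b, x0). *)
Definition iprngs (p e N : nat) :
    {set 'Z_(p ^ e) * 'Z_(p ^ e) * 'Z_(p ^ e)} :=
  [set t | [&& t.1.1 \is a GRing.unit, t.1.2 \in multiples p e &
              `[< has_period (iprng_seq t.1.1 t.1.2 t.2) N >]]].

Definition iprng_count (p e N : nat) : nat := #|iprngs p e N|.

(* Main.v *)
(* If x0 is a non-unit the sequence is constant from x1 on.  If x0 is a unit,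
   x_n is the quotient D_{n+1} / D_n of units, where D_n = U_n (x0 - b) + U_{n+1}
   and U is the Lucas sequence U_{n+2} = b U_{n+1} + a U_n; hence x_n = x0 iff
   U_n d = 0, with d = x0^2 - b x0 - a.  As p | b and p does not divide a, U_n is
   prime to p for n odd and has valuation v(b) + v(n) for n even, so the period
   is 1 if d = 0 and 2 p^max(e - v(d) - v(b), 0) otherwise.  For fixed x0 and b,
   a |-> d is a bijection, so the triples are counted by the valuations of b and
   d, where a is a unit iff d is not congruent to x0^2 - b x0 modulo p. *)

Require Import Defs.
From mathcomp Require Import all_boot all_order all_algebra.
From mathcomp Require Import boolp.
From mathcomp Require Import zify ring.

Set Implicit Arguments.
Unset Strict Implicit.
Unset Printing Implicit Defensive.

Import GRing.Theory.

Local Open Scope nat_scope.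

(** * Lucas sequences over the natural numbers *)

(** Terms are natural numbers rather than residues, so that [logn p] measures them even when they
    vanish modulo p^e. *)
Fixpoint lucas (a b n : nat) : nat :=
  match n with
  | 0 => 0
  | 1 => 1
  | (n'.+1 as m).+1 => b * lucas a b m + a * lucas a b n'
  end.

Lemma lucasSS a b n :
  lucas a b n.+2 = b * lucas a b n.+1 + a * lucas a b n.
Proof. by []. Qed.

Lemma lucasD a b m n :
  lucas a b (m.+1 + n) =
    lucas a b m.+1 * lucas a b n.+1 + a * lucas a b m * lucas a b n.
Proof.
elim: n m => [|n IHn] m; first by rewrite addn0 /= !muln1 muln0 addn0.
rewrite -addSnnS IHn !lucasSS; ring.
Qed.

Lemma lucas_gt0 a b n : 0 < a -> 0 < b -> 0 < n -> 0 < lucas a b n.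
Proof.
move=> a_gt0 b_gt0; case: n => // n _; elim: n => [|n IHn] //.
by rewrite lucasSS addn_gt0 muln_gt0 b_gt0 IHn.
Qed.

(* [lucas a b n] is the coefficient of M in M^n, where M^2 = b M + a; this
   expands (c + d M)^(n+1) modulo d^3, with c + d M = M^(m+1). *)
Lemma lucasM_expansion a b m n (d := lucas a b m.+1) (c := a * lucas a b m) :
  exists r, lucas a b (m.+1 * n.+1) =
    n.+1 * c ^ n * d + 'C(n.+1, 2) * (c ^ n.-1 * b) * d ^ 2 + r * d ^ 3.
Proof.
(* The addition law involves two consecutive terms, so the induction also carries the next term,
   needed only modulo d^2 because it gets multiplied by d. *)
suff [r [s [rE _]]] : exists r s, lucas a b (m.+1 * n.+1) =
    n.+1 * c ^ n * d + 'C(n.+1, 2) * (c ^ n.-1 * b) * d ^ 2 + r * d ^ 3 /\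
    lucas a b (m.+1 * n.+1).+1 = c ^ n.+1 + n.+1 * c ^ n * b * d + s * d ^ 2.
  by exists r.
elim: n => [|n [r [s [dE uE]]]].
  exists 0, 0; rewrite muln1 lucasSS bin_small // -/d -/c; split; ring.
have -> : m.+1 * n.+2 = m.+1 + m.+1 * n.+1 by rewrite mulnS.
have binE : 'C(n.+2, 2) = 'C(n.+1, 2) + n.+1 by rewrite binS bin1.
(* At [n = 0] the truncated [n.-1] spoils the exponent, but there the binomial coefficient is 0. *)
have cE : c * ('C(n.+1, 2) * (c ^ n.-1 * b) * d ^ 2) =
    'C(n.+1, 2) * (c ^ n * b) * d ^ 2.
  case: n {dE uE binE} => [|n]; first by rewrite bin_small //; ring.
  by rewrite [c ^ _.+1]expnS -pred_Sn; ring.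
exists (s + c * r), (b * b * n.+1 * c ^ n + b * s * d
  + a * (n.+1 * c ^ n + 'C(n.+1, 2) * (c ^ n.-1 * b) * d + r * d ^ 2) + c * s).
split.
  rewrite lucasD -/d -/c dE uE binE /= !(mulnDr c) cE !expnS; ring.
rewrite -addnS lucasD lucasSS -/d -/c dE uE !expnS; ring.
Qed.

Section LucasValuation.
Variables (p a b : nat).
Hypotheses (p_prime : prime p) (p_gt2 : 2 < p).
Hypotheses (a_gt0 : 0 < a) (b_gt0 : 0 < b) (p'a : ~~ (p %| a)) (p_b : p %| b).

Let p_gt0 : 0 < p := prime_gt0 p_prime.

(** Modulo p the recurrence reads U_(n+2) = a U_n, so odd-indexed terms are powers of a and
    even-indexed ones vanish. *)
Lemma lucas_odd_ndvd i : ~~ (p %| lucas a b i.*2.+1).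
Proof.
elim: i => [|i IHi]; first by rewrite /= gtnNdvd // prime_gt1.
rewrite doubleS lucasSS dvdn_addr; last exact: dvdn_mulr.
by rewrite Euclid_dvdM // negb_or p'a.
Qed.

Lemma dvd_lucas_even i : p %| lucas a b i.*2.
Proof.
elim: i => [|i IHi]; first exact: dvdn0.
by rewrite doubleS lucasSS dvdn_add // ?(dvdn_mulr _ p_b) ?dvdn_mull.
Qed.

(** The linear term n c^(n-1) d of the expansion dominates p-adically: c is prime to p, and each
    later term is divisible by p times the power of p in n d. *)
Lemma logn_lucasM m n : p %| lucas a b m.+1 -> ~~ (p %| lucas a b m) ->
  0 < n -> ~~ (p %| n) \/ n = p ->
  logn p (lucas a b (m.+1 * n)) = logn p (lucas a b m.+1) + logn p n.
Proof.
move=> p_d p'm; case: n => // n _ n_p; have [r ->] := lucasM_expansion a b m n.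
set c := a * _; set d := lucas a b m.+1 in p_d *.
have d_gt0 : 0 < d by apply: lucas_gt0.
have p'c : ~~ (p %| c ^ n).
  by rewrite Euclid_dvdX // negb_and Euclid_dvdM // negb_or p'a p'm.
have lognE y u : 0 < u -> ~~ (p %| y) -> logn p (u * y) = logn p u.
  move=> u_gt0 p'y; have y_gt0 : 0 < y by case: y p'y => //; rewrite dvdn0.
  by rewrite lognM // (lognE p y) (negPf p'y) !andbF addn0.
case: n_p => [p'n | n_p].
  have -> : n.+1 * c ^ n * d + 'C(n.+1, 2) * (c ^ n.-1 * b) * d ^ 2 + r * d ^ 3
    = d * (n.+1 * c ^ n + ('C(n.+1, 2) * (c ^ n.-1 * b) + r * d) * d).
    rewrite !expnS; ring.
  rewrite (lognE _ d) //; last first.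
    rewrite dvdn_addl; last exact: dvdn_mull.
    by rewrite Euclid_dvdM // negb_or p'n.
  by rewrite [logn p n.+1]prime.lognE (negPf p'n) !andbF addn0.
(* A factor d p comes out of every term: the extra p is n itself, a divisor of C(p,2) since p is
   odd, or a divisor of one d in d^3. *)
have /dvdnP[d1 d1E] := p_d.
have /dvdnP[t tE] : p %| 'C(n.+1, 2) by rewrite n_p prime_dvd_bin // p_gt2.
have -> : n.+1 * c ^ n * d + 'C(n.+1, 2) * (c ^ n.-1 * b) * d ^ 2 + r * d ^ 3
    = (d * p) * (c ^ n + (t * (c ^ n.-1 * b) + r * d1) * d).
  rewrite tE n_p !expnS d1E; ring.
rewrite lognE ?muln_gt0 ?d_gt0 ?p_gt0 //; last first.
  by rewrite dvdn_addl // dvdn_mull.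
by rewrite lognM // n_p.
Qed.

(** Factors p of i are stripped one at a time, each adding 1 to the valuation; once i is prime to p,
    the comparison is with U_2 = b. *)
Lemma logn_lucas_even i : 0 < i ->
  logn p (lucas a b i.*2) = logn p b + logn p i.
Proof.
elim/ltn_ind: i => i IHi i_gt0.
have [/dvdnP[j ji] | p'i] := boolP (p %| i); last first.
  rewrite -muln2 mulnC (@logn_lucasM 1) //=; last 2 first.
  - by rewrite gtnNdvd // prime_gt1.
  - by left.
  - by rewrite muln0 addn0 muln1.
  by rewrite muln0 addn0 muln1.
have j_gt0 : 0 < j by case: j ji i_gt0 => // ->.
have jE : j.*2 = j.-1.*2.+1.+1 by rewrite -doubleS prednK.
rewrite ji -muln2 mulnAC muln2 jE logn_lucasM //; last 3 first.
- by rewrite -jE dvd_lucas_even.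
- exact: lucas_odd_ndvd.
- by right.
rewrite -jE IHi ?lognM //; first by rewrite addnA.
by rewrite ji ltn_Pmulr // prime_gt1.
Qed.

(** For r > 0 the index must be even, and as p is odd this condition merges with the one on the
    power of p. Truncation leaves only evenness when r <= v(b). *)
Lemma dvd_lucas r n : 0 < n ->
  (p ^ r %| lucas a b n) = (r == 0) || (2 * p ^ (r - logn p b) %| n).
Proof.
case: r => [|r] n_gt0; first by rewrite dvd1n.
have U_gt0 := lucas_gt0 a_gt0 b_gt0 n_gt0.
have p'2 : ~~ (p %| 2) by rewrite gtnNdvd.
have copn2 k : coprime 2 (p ^ k) by rewrite coprimeXr // coprime_sym prime_coprime.
rewrite /= Gauss_dvd // dvdn2.
have [n_odd|n_even] := boolP (odd n).
  rewrite -[n]odd_double_half n_odd; apply: contraNF (lucas_odd_ndvd n./2).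
  by apply: dvdn_trans; rewrite dvdn_exp.
have nE : n = n./2.*2 by rewrite -[LHS]odd_double_half (negPf n_even).
have h_gt0 : 0 < n./2 by lia.
rewrite pfactor_dvdn // pfactor_dvdn // nE logn_lucas_even //.
by rewrite -muln2 lognM // [logn p 2]lognE (negPf p'2) !andbF addn0 leq_subLR.
Qed.
End LucasValuation.

(** * Periods of iterated maps *)

Section Period.
Variables (T : Type) (f : T -> T) (x : T).

Lemma has_period_unique (u : nat -> T) M N :
  has_period u M -> has_period u N -> M = N.
Proof.
move=> [M_gt0 Mu minM] [N_gt0 Nu minN].
by apply/eqP; rewrite eqn_leq minM ?minN.
Qed.

Lemma has_period_cst (u : nat -> T) (c : T) :
  (forall n, u n.+1 = c) -> has_period u 1.
Proof. by move=> uE; split=> //; exists 1 => -[] // n _; rewrite addn1 !uE. Qed.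

(** Injectivity on an invariant set [P] lets an eventual repetition be cancelled back to a return to
    [x]. The map of an IPRNG is injective on units, but it collapses all non-units to b. *)
Lemma has_period_iter (P : T -> Prop) (L : nat) :
    P x -> (forall y, P y -> P (f y)) ->
    (forall y z, P y -> P z -> f y = f z -> y = z) ->
    0 < L -> (forall n, 0 < n -> iter n f x = x <-> L %| n) ->
  has_period (fun n => iter n f x) L.
Proof.
move=> Px Pf f_inj L_gt0 Lx.
have Piter n y : P y -> P (iter n f y) by move=> Py; elim: n => //= n; apply: Pf.
have iter_inj n y z : P y -> P z -> iter n f y = iter n f z -> y = z.
  move=> Py Pz; elim: n => //= n IHn /f_inj eq_yz.
  by apply: IHn; apply: eq_yz; apply: Piter.
split=> // [|M M_gt0 [n0 /(_ n0 (leqnn _))]].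
  by exists 0 => n _; rewrite iterD (Lx L L_gt0).2.
rewrite iterD => /iter_inj eqM; apply: dvdn_leq => //.
by apply/(Lx M M_gt0)/eqM => //; apply: Piter.
Qed.
End Period.

(** * Orbits of units and their linearisation *)

Section Orbit.
Local Open Scope ring_scope.
Variables (R : comUnitRingType) (an bn : nat) (x : R).
Let a : R := an%:R.
Let b : R := bn%:R.
Hypotheses (a_unit : a \is a GRing.unit) (x_unit : x \is a GRing.unit).
Hypothesis unitDb :
  forall u : R, u \is a GRing.unit -> u + b \is a GRing.unit.

Lemma iprng_map_unit y : y \is a GRing.unit -> iprng_map a b y \is a GRing.unit.
Proof. by move=> yU; rewrite /iprng_map yU unitDb // unitrMl // unitrV. Qed.

Lemma iprng_map_inj y z : y \is a GRing.unit -> z \is a GRing.unit ->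
  iprng_map a b y = iprng_map a b z -> y = z.
Proof.
move=> yU zU; rewrite /iprng_map yU zU => /addIr/(mulrI a_unit).
exact: invr_inj.
Qed.

(* The product of the first [n] terms of the orbit. *)
Let D n : R := (lucas an bn n)%:R * (x - b) + (lucas an bn n.+1)%:R.

Let DSS n : D n.+2 = b * D n.+1 + a * D n.
Proof. rewrite /D !lucasSS !natrD !natrM !natrD !natrM -/a -/b. ring. Qed.

(** D_0 = 1, D_1 = x, and dividing the recurrence of D by D_(n+1) gives one step of y -> a/y + b.
    Invertibility is part of the induction, to stay in the inverting branch. *)
Lemma iprng_seq_prod n :
  [/\ iprng_seq a b x n \is a GRing.unit, D n \is a GRing.unit
    & D n.+1 = iprng_seq a b x n * D n].
Proof.
elim: n => [|n [sU DU DE]].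
  have D0 : D 0 = 1 by rewrite /D mul0r add0r.
  by rewrite D0 unitr1; split=> //; rewrite /D lucasSS /=; ring.
have DU' : D n.+1 \is a GRing.unit by rewrite DE unitrMl.
split=> //; first exact: iprng_map_unit.
rewrite /iprng_seq iterS {1}/iprng_map [X in if X then _ else _]sU.
by rewrite DSS mulrDl addrC [in a / _ * _]DE mulrA divrK.
Qed.

(** As D_n is a unit, a return to x means D_(n+1) = x D_n, and the terms in U_(n+1) cancel from the
    difference. *)
Lemma iprng_seq_return n :
  iprng_seq a b x n = x <-> (lucas an bn n)%:R * (x ^+ 2 - b * x - a) = 0.
Proof.
have [sU DU DE] := iprng_seq_prod n.
have eqDx : D n.+1 - x * D n = - ((lucas an bn n)%:R * (x ^+ 2 - b * x - a)).
  by rewrite /D lucasSS natrD !natrM -/a -/b; ring.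
split=> [sx | /eqP].
  by apply/eqP; rewrite -oppr_eq0 -eqDx DE sx subrr.
by rewrite -oppr_eq0 -eqDx subr_eq0 DE => /eqP/(mulIr DU).
Qed.

Lemma has_period_iprng_seq L : (0 < L)%N ->
  (forall n, (0 < n)%N ->
    (lucas an bn n)%:R * (x ^+ 2 - b * x - a) = 0 <-> (L %| n)%N) ->
  has_period (iprng_seq a b x) L.
Proof.
move=> L_gt0 LE; apply: (@has_period_iter _ _ _ (fun y => y \is a GRing.unit)).
- exact: x_unit.
- exact: iprng_map_unit.
- exact: iprng_map_inj.
- exact: L_gt0.
- by move=> n n_gt0; rewrite -LE //; apply: iprng_seq_return.
Qed.
End Orbit.

Lemma has_period_iprng_seq_nonunit (R : comUnitRingType) (a b x : R) :
  x \isn't a GRing.unit -> b \isn't a GRing.unit ->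
  has_period (iprng_seq a b x) 1.
Proof.
move=> xU bU; apply: (@has_period_cst _ _ b) => n.
rewrite /iprng_seq; elim: n => [|n IHn]; first by rewrite /= /iprng_map (negPf xU).
by rewrite iterS IHn /iprng_map (negPf bU).
Qed.

Lemma sum_dvdn_ord d n : 0 < d -> d %| n -> \sum_(i < n) (d %| i) = n %/ d.
Proof.
case: n => [|n] d_gt0 d_n; first by rewrite big_ord0 div0n.
rewrite divn_count_dvd big_add1 /= big_mkord.
(* The index 0 on the left is traded for [n.+1] on the right, both multiples of d. *)
rewrite [LHS]big_ord_recl [RHS]big_ord_recr /= dvdn0 d_n addnC.
by congr (_ + _); apply: eq_bigr => i _.
Qed.

(** * Valuations in Z/p^e and the period they determine *)

Section ZpPow.
Variables (p e : nat).
Hypotheses (p_prime : prime p) (p_gt2 : 2 < p) (e_gt0 : 0 < e).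

Let p_gt1 : 1 < p := prime_gt1 p_prime.
Let p_gt0 : 0 < p := prime_gt0 p_prime.
Let q_gt1 : 1 < p ^ e.
Proof. by rewrite -(exp1n e) ltn_exp2r. Qed.
Let q_gt0 : 0 < p ^ e := ltnW q_gt1.

Local Notation Zq := 'Z_(p ^ e).

Lemma Zq_ltn (z : Zq) : z < p ^ e.
Proof. by rewrite -[X in _ < X](Zp_cast q_gt1). Qed.

Lemma natr_Zq_eq0 n : (n%:R = 0 :> Zq)%R <-> p ^ e %| n.
Proof.
split=> [/(congr1 val)|/eqP n0]; first by rewrite /= val_Zp_nat // => /eqP.
by apply: val_inj; rewrite /= val_Zp_nat.
Qed.

Lemma unit_Zq (z : Zq) : (z \is a GRing.unit) = ~~ (p %| z).
Proof. by rewrite -[z in LHS]natr_Zp unitZpE // coprime_pexpl // prime_coprime. Qed.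

Lemma dvdn_Zq_natr n : (p %| (n%:R : Zq)%R) = (p %| n).
Proof. by rewrite val_Zp_nat // /dvdn modn_dvdm // dvdn_exp. Qed.

Lemma dvdn_ZqD (y z : Zq) : p %| y -> (p %| (z + y)%R) = (p %| z).
Proof.
move=> p_y; rewrite -[y]natr_Zp -[z in LHS]natr_Zp -natrD dvdn_Zq_natr.
by rewrite dvdn_addl.
Qed.

Lemma dvdn_ZqMl (y z : Zq) : p %| y -> p %| (z * y)%R.
Proof.
move=> p_y; rewrite -[y]natr_Zp -[z]natr_Zp -natrM dvdn_Zq_natr.
exact: dvdn_mull.
Qed.

Lemma mem_multiples (z : Zq) : (z \in multiples p e) = (p %| z).
Proof.
apply/imsetP/idP => [[y _ ->]|/dvdnP[m zE]].
  by rewrite mulrC dvdn_ZqMl // dvdn_Zq_natr.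
by exists m%:R%R => //; rewrite -natrM mulnC -zE natr_Zp.
Qed.

(* The representative of [z] in [1, p ^ e]: with it 0 has valuation [e]. *)
Definition pos_rep (z : Zq) : nat := if z == 0%R then p ^ e else z.

Definition pval (z : Zq) : nat := logn p (pos_rep z).

Lemma pos_rep_gt0 z : 0 < pos_rep z.
Proof. by rewrite /pos_rep; case: eqP => // /eqP; rewrite -lt0n. Qed.

Lemma natr_pos_rep z : ((pos_rep z)%:R = z)%R.
Proof.
rewrite /pos_rep; case: eqP => [-> | _]; last exact: natr_Zp.
exact/natr_Zq_eq0.
Qed.

(** The bound on j matters at z = 0, which has valuation e but is divisible by every p^j. *)
Lemma leq_pval j z : j <= e -> (j <= pval z) = (p ^ j %| z).
Proof.
move=> le_je; rewrite -pfactor_dvdn ?pos_rep_gt0 // /pos_rep.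
by case: eqP => [-> | //]; rewrite dvdn0 dvdn_exp2l.
Qed.

Lemma pval_gt0 z : (0 < pval z) = (p %| z).
Proof. by rewrite leq_pval // expn1. Qed.

Lemma pval_eqe z : (pval z == e) = (z == 0%R).
Proof.
apply/eqP/eqP => [ze | ->]; last by rewrite /pval /pos_rep eqxx pfactorK.
have : p ^ e %| z by rewrite -leq_pval // ze.
by move/natr_Zq_eq0; rewrite natr_Zp.
Qed.

Lemma pval_leq z : pval z <= e.
Proof.
have [z0|nz] := boolP (z == 0%R); first by rewrite (eqP _ : pval z = e) // pval_eqe.
rewrite -(@leq_exp2l p) //; apply: leq_trans (ltnW (Zq_ltn z)).
by rewrite /pval /pos_rep (negPf nz); apply/dvdn_leq/pfactor_dvdnn; rewrite lt0n.
Qed.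

Lemma sum_leq_pval j : j <= e -> \sum_(z : Zq) (j <= pval z) = p ^ (e - j).
Proof.
move=> le_je; rewrite expnB // -[in RHS](Zp_cast q_gt1) -sum_dvdn_ord.
- by apply: eq_bigr => z _; rewrite leq_pval.
- by rewrite expn_gt0 p_gt0.
- by rewrite Zp_cast // dvdn_exp2l.
Qed.

(** The number of residues of valuation k: p^(e-k) - p^(e-k-1) for k < e, and the zero residue alone
    for k = e. *)
Definition nval k := if k == e then 1 else (p - 1) * p ^ (e - k - 1).

Lemma sum_pval_eq k : k <= e -> \sum_(z : Zq) (pval z == k) = nval k.
Proof.
move=> le_ke; rewrite /nval; case: eqP => [-> | ke].
  have := sum_leq_pval (leqnn e); rewrite subnn expn0 => <-.
  by apply: eq_bigr => z _; rewrite eqn_leq pval_leq.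
have lt_ke : k < e by lia.
have powE : p ^ (e - k) = (p - 1) * p ^ (e - k - 1) + p ^ (e - k.+1).
  have -> : e - k = (e - k.+1).+1 by lia.
  by rewrite [_.+1 - 1]subn1 /= expnS mulnBl mul1n subnK // leq_pmull.
apply: (@addIn (p ^ (e - k.+1))); rewrite /= -powE -!sum_leq_pval //.
by rewrite -big_split; apply: eq_bigr => z _; case: ltngtP.
Qed.

Lemma sum_unit_Zq : \sum_(z : Zq | z \is a GRing.unit) 1 = (p - 1) * p ^ (e - 1).
Proof.
have := sum_pval_eq (leq0n e); rewrite /nval ltn_eqF // subn0 => <-.
rewrite big_mkcond; apply: eq_bigr => z _; rewrite unit_Zq -pval_gt0.
by case: pval.
Qed.

Lemma sum_multiples : \sum_(z : Zq | p %| z) 1 = p ^ (e - 1).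
Proof.
rewrite -sum_leq_pval // big_mkcond.
by apply: eq_bigr => z _; rewrite pval_gt0; case: ifP.
Qed.

Lemma sum_pval_gt0 (F : nat -> nat) :
  \sum_(z : Zq | p %| z) F (pval z) = \sum_(1 <= k < e.+1) nval k * F k.
Proof.
transitivity (\sum_(1 <= k < e.+1) \sum_(z : Zq) (pval z == k) * F k).
  rewrite exchange_big big_mkcond; apply: eq_bigr => z _ /=.
  rewrite -pval_gt0; case: ifP => z_gt0.
    rewrite (bigD1_seq (pval z)) ?iota_uniq ?mem_index_iota ?z_gt0 ?ltnS ?pval_leq //=.
    rewrite eqxx mul1n big1 ?addn0 // => k; rewrite eq_sym => /negPf-> //.
  rewrite big_nat big1 // => k /andP[k_gt0 _].
  by move/negbT: z_gt0; rewrite -eqn0Ngt => /eqP->; rewrite ltn_eqF.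
rewrite big_nat [RHS]big_nat; apply: eq_bigr => k /andP[_ lt_ke].
by rewrite -big_distrl sum_pval_eq.
Qed.
(* [k] and [s] are the valuations of b and x0^2 - b x0 - a; the truncated
   subtraction makes the period 2 when they add up to at least [e]. *)
Definition period k s := if s == e then 1 else 2 * p ^ (e - s - k).

Lemma period_gt0 k s : 0 < period k s.
Proof. by rewrite /period; case: ifP => // _; rewrite muln_gt0 expn_gt0 p_gt0. Qed.

(** With positive representatives, U_n d = 0 becomes v(U_n) >= e - s, which is [dvd_lucas] at r = e
    - s; the case r = 0 is d = 0. *)
Lemma has_period_Zq (a b x : Zq) :
    a \is a GRing.unit -> p %| b -> x \is a GRing.unit ->
  has_period (iprng_seq a b x)
    (period (pval b) (pval (x ^+ 2 - b * x - a)%R)).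
Proof.
move=> a_unit p_b x_unit; set s := pval (_ - a)%R.
have p'a : ~~ (p %| pos_rep a).
  by rewrite -dvdn_Zq_natr natr_pos_rep -unit_Zq.
have p_b' : p %| pos_rep b by rewrite -dvdn_Zq_natr natr_pos_rep.
rewrite -[a in iprng_seq a]natr_pos_rep -[b in iprng_seq _ b]natr_pos_rep.
apply: has_period_iprng_seq; rewrite ?natr_pos_rep ?period_gt0 //.
  by move=> u; rewrite !unit_Zq dvdn_ZqD.
move=> n n_gt0; rewrite -[X in (_ * X)%R]natr_pos_rep -natrM natr_Zq_eq0.
have U_gt0 : 0 < lucas (pos_rep a) (pos_rep b) n by rewrite lucas_gt0 ?pos_rep_gt0.
rewrite pfactor_dvdn ?muln_gt0 ?U_gt0 ?pos_rep_gt0 // lognM ?pos_rep_gt0 //.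
rewrite -/(pval _) -/s addnC -leq_subLR -pfactor_dvdn //.
rewrite dvd_lucas ?pos_rep_gt0 //.
rewrite /period subn_eq0 -/(pval b); have := pval_leq (x ^+ 2 - b * x - a)%R.
rewrite -/s eqn_leq => -> /=.
by case: leqP => // _; rewrite dvd1n.
Qed.

(** * Counting triples by the valuations of b and d *)

(** The sum over a is innermost because a is to be traded for d = x^2 - b x - a with x and b
    fixed. *)
Lemma iprng_count_sum N :
  iprng_count p e N =
    \sum_(x : Zq) \sum_(b : Zq | p %| b) \sum_(a : Zq | a \is a GRing.unit)
      `[< has_period (iprng_seq a b x) N >].
Proof.
pose G (t : Zq * Zq * Zq) : nat := t \in iprngs p e N.
transitivity (\sum_x \sum_b \sum_a G (a, b, x)).
  rewrite exchange_big; under eq_bigr do rewrite exchange_big.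
  rewrite exchange_big /= pair_bigA pair_bigA /= /iprng_count -sum1_card.
  by rewrite big_mkcond; apply: eq_bigr => -[[a b] x] _; rewrite /G; case: ifP.
apply: eq_bigr => x _; rewrite [RHS]big_mkcond; apply: eq_bigr => b _.
rewrite -mem_multiples; case: ifP => b_mul; last first.
  by rewrite big1 // => a _; rewrite /G inE /= b_mul andbF.
rewrite [RHS]big_mkcond; apply: eq_bigr => a _ /=.
by rewrite /G inE /= b_mul; case: ifP.
Qed.

Lemma asbool_has_period (T : Type) (u : nat -> T) L N :
  has_period u L -> `[< has_period u N >] = (L == N).
Proof.
move=> uL; apply/asboolP/eqP => [|<- //].
exact: has_period_unique.
Qed.

(** Here u stands for x^2 - b x and u - d for a. Every multiple d of p is allowed; among the units d
    the class of u modulo p is excluded, which leaves p - 2 classes, all of valuation 0. *)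
Lemma sum_unit_diff (u : Zq) (F : nat -> nat) : u \is a GRing.unit ->
  \sum_(d : Zq | (u - d)%R \is a GRing.unit) F (pval d) =
    (p - 2) * p ^ (e - 1) * F 0 + \sum_(1 <= s < e.+1) nval s * F s.
Proof.
move=> u_unit; rewrite -sum_pval_gt0 addnC (bigID (fun d : Zq => p %| d)) /=.
have unitB (d : Zq) : p %| d -> (u - d)%R \is a GRing.unit.
  by move=> p_d; rewrite unit_Zq -mulN1r dvdn_ZqD ?dvdn_ZqMl // -unit_Zq.
congr (_ + _).
  by apply: eq_bigl => d; case p_d: (p %| d); rewrite ?andbF ?unitB.
pose S := \sum_(d : Zq | (u - d)%R \is a GRing.unit) 1.
have SE : S = (p - 1) * p ^ (e - 1).
  rewrite -sum_unit_Zq /S (reindex_inj (can_inj (subKr u))) /=.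
  by apply: eq_bigl => d; rewrite subKr.
have : S = p ^ (e - 1) +
    \sum_(d : Zq | ((u - d)%R \is a GRing.unit) && ~~ (p %| d)) 1.
  rewrite /S (bigID (fun d : Zq => p %| d)) -sum_multiples /=; congr (_ + _).
  by apply: eq_bigl => d; case p_d: (p %| d); rewrite ?andbF ?unitB.
rewrite SE => /esym/(canRL (addKn _)) cardE.
transitivity (\sum_(d : Zq | ((u - d)%R \is a GRing.unit) && ~~ (p %| d)) 1 * F 0).
  apply: eq_bigr => d /andP[_]; rewrite -pval_gt0 -eqn0Ngt => /eqP->.
  by rewrite mul1n.
rewrite -big_distrl /= cardE /=; congr (_ * _).
by rewrite -{2}[p ^ _]mul1n -mulnBl -subnDA.
Qed.

(** The first summand collects the non-units x0. For a unit x0 the inner sum depends only on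
    valuations, so it is the same for all of them. *)
Lemma iprng_count_valuations N :
  iprng_count p e N =
    p ^ (e - 1) * (p ^ (e - 1) * ((p - 1) * p ^ (e - 1) * (1 == N)))
  + (p - 1) * p ^ (e - 1) * \sum_(1 <= k < e.+1) nval k *
      ((p - 2) * p ^ (e - 1) * (period k 0 == N)
       + \sum_(1 <= s < e.+1) nval s * (period k s == N)).
Proof.
rewrite iprng_count_sum (bigID (fun x : Zq => p %| x)) /=; congr (_ + _).
  rewrite -{1}sum_multiples big_distrl; apply: eq_bigr => x p_x /=.
  rewrite mul1n -{1}sum_multiples big_distrl; apply: eq_bigr => b p_b /=.
  rewrite mul1n -sum_unit_Zq big_distrl; apply: eq_bigr => a a_unit /=.
  rewrite mul1n (@asbool_has_period _ _ 1) //.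
  by apply: has_period_iprng_seq_nonunit; rewrite unit_Zq negbK.
rewrite -sum_unit_Zq big_distrl; apply: eq_big => [x|x p'x].
  by rewrite unit_Zq.
rewrite /= mul1n -(sum_pval_gt0 (fun k => _ * (period k 0 == N) + _)).
apply: eq_bigr => b p_b.
have x_unit : x \is a GRing.unit by rewrite unit_Zq.
have u_unit : (x ^+ 2 - b * x)%R \is a GRing.unit.
  rewrite unit_Zq mulrC -mulNr dvdn_ZqD; last exact: dvdn_ZqMl.
  by rewrite -unit_Zq unitrX.
rewrite -(sum_unit_diff (fun s => period (pval b) s == N) u_unit).
rewrite (reindex_inj (can_inj (subKr (x ^+ 2 - b * x)%R))) /=.
apply: eq_bigr => d d_unit.
rewrite (asbool_has_period _ (has_period_Zq d_unit p_b x_unit)).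
by rewrite subKr.
Qed.

(** * Evaluation of the sums for each period *)

(** Of the p^(e-j) residues of valuation at least j, the zero residue, of valuation e, is left
    out. *)
Lemma sum_nval_tail j : 0 < j <= e ->
  \sum_(j <= k < e) nval k = p ^ (e - j) - 1.
Proof.
case/andP=> j_gt0 le_je; apply: (canRL (addnK _)).
have <- : nval e = 1 by rewrite /nval eqxx.
rewrite -big_nat_recr //= -sum_leq_pval //.
transitivity (\sum_(1 <= k < e.+1) nval k * (j <= k)).
  rewrite [RHS](big_cat_nat (n := j)) //=; last by rewrite leqW.
  rewrite [X in _ = X + _]big_nat [X in _ = X + _]big1 => [|k /andP[_ lt_kj]]; last first.
    by rewrite leqNgt lt_kj muln0.
  rewrite add0n big_nat [RHS]big_nat; apply: eq_bigr => k /andP[le_jk _].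
  by rewrite le_jk muln1.
rewrite -(sum_pval_gt0 (fun k => (j <= k) : nat)) big_mkcond.
apply: eq_bigr => z _; rewrite -pval_gt0; case: ltnP => //.
by rewrite leqn0 => /eqP->; rewrite leqNgt j_gt0.
Qed.

Lemma period_eq1 k s : (period k s == 1) = (s == e).
Proof. by rewrite /period; case: ifP => // _; rewrite muln_eq1. Qed.

Lemma period_eq2X k s j :
  (period k s == 2 * p ^ j) = (s != e) && (e - s - k == j).
Proof.
rewrite /period; case: ifP => _; first by rewrite eq_sym muln_eq1.
by rewrite eqn_pmul2l // eqn_exp2l.
Qed.

Lemma nval_lt k : k < e -> nval k = (p - 1) * p ^ (e - k - 1).
Proof. by move=> lt_ke; rewrite /nval ltn_eqF. Qed.

Lemma nval_e : nval e = 1.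
Proof. by rewrite /nval eqxx. Qed.

Lemma iprng_count1 :
  iprng_count p e 1 = (p - 1) * (p ^ (3 * e - 3) + p ^ (2 * e - 2)).
Proof.
rewrite iprng_count_valuations eqxx.
(* For given b and unit x0, only d = 0 yields period 1. *)
have inner k : (p - 2) * p ^ (e - 1) * (period k 0 == 1)
    + \sum_(1 <= s < e.+1) nval s * (period k s == 1) = 1.
  rewrite period_eq1 ltn_eqF // muln0 add0n big_nat_recr //= period_eq1 eqxx.
  rewrite nval_e big_nat big1 // => s /andP[_ lt_se].
  by rewrite period_eq1 ltn_eqF ?muln0.
under eq_bigr do rewrite inner muln1.
rewrite big_nat_recr //= sum_nval_tail ?e_gt0 // nval_e.
rewrite subnK ?expn_gt0 ?p_gt0 //.
have -> : 3 * e - 3 = (e - 1) + ((e - 1) + (e - 1)) by lia.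
have -> : 2 * e - 2 = (e - 1) + (e - 1) by lia.
rewrite !expnD; ring.
Qed.

Lemma iprng_count2 :
  iprng_count p e 2 = (e * p - e - 1) * (p - 1) * p ^ (2 * e - 2).
Proof.
rewrite iprng_count_valuations !muln0 add0n.
have eq2 k s : (period k s == 2) = (s != e) && (e - s - k == 0).
  by rewrite -period_eq2X muln1.
(* [m] is the least positive valuation of d from which the period drops to 2: 1 for b = 0, and e - k
   otherwise. *)
have tail k m : 0 < m <= e -> (forall s, 0 < s < e -> (e - s - k == 0) = (m <= s)) ->
    \sum_(1 <= s < e.+1) nval s * (period k s == 2) = p ^ (e - m) - 1.
  move=> m_e mE; case/andP: (m_e) => m_gt0 le_me.
  rewrite -sum_nval_tail // big_nat_recr //= eq2 eqxx muln0 addn0.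
  rewrite (big_cat_nat (n := m)) //= [X in X + _]big_nat big1.
    rewrite add0n big_nat [RHS]big_nat; apply: eq_bigr => s /andP[le_ms lt_se].
    by rewrite eq2 ltn_eqF // mE ?le_ms ?muln1 // lt_se (leq_trans m_gt0).
  move=> s /andP[s_gt0 lt_sm]; have lt_se := leq_trans lt_sm le_me.
  by rewrite eq2 mE ?s_gt0 // leqNgt lt_sm andbF muln0.
rewrite big_nat_recr //= nval_e mul1n eq2 ltn_eqF // subn0 subnn eqxx /= muln1.
rewrite (tail e 1) // => [|s]; last by lia.
(* There are p^k - 1 nonzero d of valuation at least e - k; adding [nval k] back makes the total
   independent of k. *)
have termE k : 0 < k < e -> nval k * ((p - 2) * p ^ (e - 1) * (period k 0 == 2)
    + \sum_(1 <= s < e.+1) nval s * (period k s == 2)) + nval k =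
    (p - 1) * p ^ (e - 1).
  move=> /andP[k_gt0 lt_ke]; rewrite eq2 subn0 subn_eq0 leqNgt lt_ke andbF.
  rewrite muln0 add0n (tail k (e - k)); [|lia|by move=> s; lia].
  rewrite -mulnSr -addn1 subnK ?expn_gt0 ?p_gt0 // nval_lt // -mulnA -expnD.
  by congr (_ * p ^ _); lia.
(* The share p^(e-1) - 1 of b = 0 is exactly the sum of the [nval k] that complete these terms. *)
rewrite addnCA.
have -> : \sum_(1 <= k < e) nval k * ((p - 2) * p ^ (e - 1) * (period k 0 == 2)
    + \sum_(1 <= s < e.+1) nval s * (period k s == 2)) + (p ^ (e - 1) - 1) =
    (e - 1) * ((p - 1) * p ^ (e - 1)).
  rewrite -sum_nval_tail ?e_gt0 // -big_split /= -[RHS]sum_nat_const_nat.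
  by rewrite big_nat [RHS]big_nat; apply: eq_bigr => k; apply: termE.
have -> : 2 * e - 2 = (e - 1) + (e - 1) by lia.
have -> : e * p - e - 1 = (p - 2) + (e - 1) * (p - 1) by nia.
rewrite expnD; ring.
Qed.

(** As j > 0, the period forces k + s = e - j without truncation. The case s = 0 gives the first
    term, s > 0 the double sum, and b = 0 nothing. *)
Lemma iprng_count2X j : 1 <= j <= e - 1 ->
  iprng_count p e (2 * p ^ j) =
    (p - 1) ^ 2 * (p - 2) * p ^ (3 * e - (e - j) - 3)
    + \sum_(1 <= k < e) \sum_(1 <= s < e - k | e - k - s == j)
        (p - 1) ^ 3 * p ^ (3 * e - k - s - 3).
Proof.
move=> /andP[j_gt0 le_j]; rewrite iprng_count_valuations.
(* Non-units x0 drop out, since 2 p^j is not 1. *)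
rewrite [1 == _]eq_sym muln_eq1 /= !muln0 add0n.
have inner k : 0 < k -> \sum_(1 <= s < e.+1) nval s * (period k s == 2 * p ^ j)
    = \sum_(1 <= s < e - k | e - k - s == j) nval s.
  move=> k_gt0; rewrite big_nat_recr //= period_eq2X eqxx muln0 addn0.
  have [le_ke1 | lt_ek1] := leqP 1 (e - k); last first.
    rewrite [RHS]big_geq ?(ltnW lt_ek1) // big_nat big1 // => s /andP[s_gt0 lt_se].
    by rewrite period_eq2X (_ : _ && _ = false) ?muln0 //; lia.
  rewrite (big_cat_nat (n := e - k)) ?leq_subr //= [X in _ + X]big_nat.
  rewrite [X in _ + X]big1 => [|s /andP[le_s lt_s]]; last first.
    by rewrite period_eq2X (_ : _ && _ = false) ?muln0 //; lia.
  rewrite addn0 big_nat [RHS]big_mkcond [RHS]big_nat.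
  apply: eq_bigr => s /andP[s_gt0 lt_s].
  rewrite period_eq2X subnAC ltn_eqF /=; last exact: leq_trans lt_s (leq_subr _ _).
  by case: ifP; rewrite ?muln1 ?muln0.
rewrite big_nat_recr //= period_eq2X subn0 subnn inner // subnn.
rewrite [\sum_(1 <= s < 0 | _) _]big_geq // (ltn_eqF j_gt0) andbF !muln0 !addn0.
rewrite big_nat; under eq_bigr => k /andP[k_gt0 lt_ke].
  rewrite inner // period_eq2X ltn_eqF // subn0 mulnDr /=; over.
rewrite -big_nat big_split /= mulnDr; congr (_ + _).
  rewrite (bigD1_seq (e - j)) ?iota_uniq ?mem_index_iota //=; last lia.
  rewrite subKn; last lia.
  rewrite eqxx big_nat_cond big1 ?addn0 ?muln1 => [|k /andP[/andP[k_gt0 lt_ke] ne_k]].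
    rewrite nval_lt; last lia.
    have -> : 3 * e - (e - j) - 3 = (e - 1) + (e - (e - j) - 1) + (e - 1) by lia.
    rewrite !expnD; ring.
  by rewrite (_ : (e - k == j) = false) ?muln0 //; lia.
rewrite big_distrr big_nat [RHS]big_nat; apply: eq_bigr => k /andP[k_gt0 lt_ke] /=.
rewrite mulnA big_distrr big_nat_cond [RHS]big_nat_cond.
apply: eq_bigr => s /andP[/andP[s_gt0 lt_s] _] /=.
rewrite !nval_lt //; last lia.
have -> : 3 * e - k - s - 3 = (e - 1) + (e - k - 1) + (e - s - 1) by lia.
rewrite !expnD; ring.
Qed.

(** Since k >= 1, the exponent e - s - k is at most e - 1, so [period] takes only the listed
    values. *)
Lemma iprng_count0 N : N <> 1 -> N <> 2 ->
  (forall j, 1 <= j <= e - 1 -> N <> 2 * p ^ j) -> iprng_count p e N = 0.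
Proof.
move=> N1 N2 NX; rewrite iprng_count_valuations.
have periodN k s : 0 < k -> period k s == N = false.
  move=> k_gt0; apply/eqP; rewrite /period; case: ifP => [_ /esym // | _ NE].
  have [ek | ek] := eqVneq (e - s - k) 0; first by apply: N2; rewrite -NE ek muln1.
  by apply: (NX (e - s - k)) => //; lia.
rewrite (_ : 1 == N = false); last by apply/eqP => /esym.
rewrite !muln0 add0n big_nat big1 ?muln0 // => k /andP[k_gt0 _].
rewrite periodN // muln0 add0n big1 ?muln0 // => s _.
by rewrite periodN // muln0.
Qed.
End ZpPow.

Theorem theorem2 (p e : nat) (p_prime : prime p) (p_gt3 : 3 < p)
    (e_ge2 : 2 <= e) :
  [/\ iprng_count p e 1 =
        (p - 1) * (p ^ (3 * e - 3) + p ^ (2 * e - 2)),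
      iprng_count p e 2 =
        (e * p - e - 1) * (p - 1) * p ^ (2 * e - 2),
      forall j : nat, 1 <= j <= e - 1 ->
        iprng_count p e (2 * p ^ j) =
          (p - 1) ^ 2 * (p - 2) * p ^ (3 * e - (e - j) - 3)
          + \sum_(1 <= k < e) \sum_(1 <= s < e - k | e - k - s == j)
              (p - 1) ^ 3 * p ^ (3 * e - k - s - 3)
    & forall N : nat, 0 < N -> N <> 1 -> N <> 2 ->
        (forall j : nat, 1 <= j <= e - 1 -> N <> 2 * p ^ j) ->
        iprng_count p e N = 0].
Proof.
have p_gt2 : 2 < p := ltnW p_gt3.
have e_gt0 : 0 < e := ltnW e_ge2.
split.
- exact: iprng_count1.
- exact: iprng_count2.
- exact: iprng_count2X.
- by move=> N _; apply: iprng_count0.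
Qed.
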